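(* Let $\Delta\subseteq\mathbb{R}_+$ be a distance set and let $Z$ be a standard Borel space. Then the only ergodic probability measures on $Z^{\mathbb{U}_\Delta}$ that are invariant under the shift action $\mathrm{Isom}(\mathbb{U}_\Delta)\curvearrowright Z^{\mathbb{U}_\Delta}$ are product measures of the form $\lambda^{\mathbb{U}_\Delta}$, where $\lambda$ is a Borel probability measure on $Z$.
   Context: A distance set is either a countable additive subsemigroup of the non-negative reals containing $0$, or the intersection $\mathcal{S}\cap[0,r]$ of such a semigroup $\mathcal{S}$ with a bounded interval $[0,r]$, where $r\in\mathcal{S}$. A $\Delta$-metric space is a metric space whose metric takes values in $\Delta$. The Urysohn $\Delta$-metric space $\mathbb{U}_\Delta$ is the unique (up to isometry) countable $\Delta$-metric space which is ultrahomogeneous (every isometry between finite subsets extends to an isometry of $\mathbb{U}_\Delta$ onto itself) and universal (every countable $\Delta$-metric space embeds isometrically into $\mathbb{U}_\Delta$). $\mathrm{Isom}(\mathbb{U}_\Delta)$ is the group of isometries of $\mathbb{U}_\Delta$ onto itself, with the Polish topology of pointwise convergence, $\mathbb{U}_\Delta$ being viewed as a discrete topological space. The shift action of $G=\mathrm{Isom}(\mathbb{U}_\Delta)$ on $Z^{\mathbb{U}_\Delta}$ is $g\cdot(z_\omega)_{\omega}=(z_{g^{-1}(\omega)})_{\omega}$. An invariant Borel probability measure $\mu$ is ergodic if every measurable $Y$ with $\mu(gY\triangle Y)=0$ for all $g\in G$ has $\mu(Y)\in\{0,1\}$. *)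

(* Defs.v *)
From HB Require Import structures.
From mathcomp Require Import all_boot all_order all_algebra.
From mathcomp Require Import all_classical all_reals all_analysis.

Set Implicit Arguments.
Unset Strict Implicit.
Unset Printing Implicit Defensive.

Import Order.TTheory GRing.Theory Num.Theory.

Local Open Scope classical_set_scope.
Local Open Scope ring_scope.

Section DistanceSets.
Variable R : realType.

Definition distance_semigroup (S : set R) : Prop :=
  [/\ countable S, S `<=` [set x | 0 <= x], S 0 &
      forall x y, S x -> S y -> S (x + y)].

Definition distance_set (Delta : set R) : Prop :=
  distance_semigroup Delta \/
  exists (S : set R) (r : R),
    [/\ distance_semigroup S, S r & Delta = S `&` `[0, r]].

End DistanceSets.

Section UrysohnSpace.
Variables (R : realType) (Delta : set R).

Definition isometric_on (X Y : metricType R) (A : set X) (f : X -> Y) : Prop :=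
  forall x y, A x -> A y -> mdist (f x) (f y) = mdist x y.

Definition delta_metric (X : metricType R) : Prop :=
  forall x y : X, Delta (mdist x y).

Record isom (X : metricType R) := Isom {
  isom_fun :> X -> X ;
  isom_inv : X -> X ;
  isom_funK : cancel isom_fun isom_inv ;
  isom_invK : cancel isom_inv isom_fun ;
  isom_isometric : isometric_on setT isom_fun
}.

(* A partial isometry A -> B is the restriction to A of a total function f;
   its values outside A are irrelevant. *)
Definition ultrahomogeneous (U : metricType R) : Prop :=
  forall (A B : set U) (f : U -> U),
    finite_set A -> finite_set B -> set_bij A B f -> isometric_on A f ->
    exists g : isom U, forall x, A x -> g x = f x.

Definition delta_universal (U : metricType R) : Prop :=
  forall X : metricType R, countable [set: X] -> delta_metric X ->
    exists f : X -> U, isometric_on setT f.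

Definition urysohn_space (U : metricType R) : Prop :=
  [/\ countable [set: U], delta_metric U, ultrahomogeneous U &
      delta_universal U].

End UrysohnSpace.

(* Z is Borel isomorphic to a Polish space T.  A Hausdorff pseudometric is a
   metric. *)
Definition standard_borel (R : realType) d (Z : measurableType d) : Prop :=
  exists (T : completePseudoMetricType R) (f : Z -> T),
    [/\ hausdorff_space T,
        exists2 D : set T, countable D & dense D,
        bijective f &
        forall A : set T, <<s @open T >> A <-> measurable (f @^-1` A)].

Section ShiftAction.
Variables (R : realType) (U : metricType R) (d : measure_display).
Variable Z : measurableType d.

Definition coordinate_sets : set (set (U -> Z)) :=
  \bigcup_(u : U) preimage_set_system setT (fun z : U -> Z => z u) measurable.

Definition power_space := g_sigma_algebraType coordinate_sets.

Definition shift (g : isom U) (z : power_space) : power_space :=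
  fun u => z (isom_inv g u).

Variable mu : probability power_space R.

Definition shift_invariant : Prop :=
  forall (g : isom U) (A : set power_space), measurable A ->
    mu (shift g @` A) = mu A.

Definition shift_ergodic : Prop :=
  forall Y : set power_space, measurable Y ->
    (forall g : isom U, mu ((shift g @` Y) `+` Y) = 0%E) ->
    mu Y = 0%E \/ mu Y = 1%E.

(* mu is lambda^U: the product measure is the unique probability measure with
   these values on the boxes having finitely many constrained coordinates. *)
Definition is_power_measure (lambda : probability Z R) : Prop :=
  forall (s : seq U) (B : U -> set Z), uniq s ->
    (forall u, measurable (B u)) ->
    mu [set z : power_space | forall u, u \in s -> B u (z u)] =
    (\prod_(u <- s) lambda (B u))%E.

End ShiftAction.

(* Main.v *)
Require Import Defs.
From HB Require Import structures.
From mathcomp Require Import all_boot all_order all_algebra.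
From mathcomp Require Import all_classical all_reals all_analysis.
From mathcomp Require Import measurable_realfun zify ring lra.

(** The coordinates of a random point of [U -> Z] with an invariant law are
    identically distributed, because any two points of [U] are exchanged by
    an isometry. What has to be shown is that a coordinate [z u] is
    independent of finitely many other coordinates [z a]; the product
    formula follows by induction on the number of coordinates.

    Fix a measurable [B] and consider the events [z x \in B] for [x] in [U].
    By invariance the correlation of two of them, the probability [c (t)]
    that both hold, is a function of the distance [t] of the two points. The
    key fact is that [c] is constant on the nonzero distances. Let [s] and
    [t] be nonzero distances, each at most twice the other. By universality
    [U] contains three infinite families [A], [B] and [H] of points with all
    distances equal to [s], except that the distances from [A] to [B] are
    [t]. In L2, the averages of the indicators over these families tend to
    vectors [a], [b] and [h] whose scalar products are [c (s)], except for
    [<a, b> = c (t)]; from [0 <= |a + b - 2 h| ^ 2] follows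
    [c (s) <= c (t)], and equality holds by symmetry ([hub_correlation_le],
    [corr_le]). Two arbitrary distances [s < t] are connected by the
    multiples of [s] up to [t], which are distances too ([corr_const]).

    Thus the events are exchangeable up to second moments, and the averages
    of their indicators along any sequence of distinct points converge to
    the same limit ([ae_avg_lim], [ae_avg_lim_eq]). This limit is therefore
    invariant under isometries, and constant by ergodicity
    ([zero_one_avg_lim], [zero_one_independent]).

    Finally, given [u] and other points [a], the space [U] contains a
    sequence of distinct points having the same distances to isometric
    copies of the [a] as [u] has to the [a]. By invariance, the probability
    of [z u \in B] together with an event [C] about the [z a] is the
    integral over the copy of [C] of the averages along this sequence. Their
    limit is the constant [p = mu (z u \in B)], so the probability is
    [p * mu C] ([event_box_independent]). *)

Set Implicit Arguments.
Unset Strict Implicit.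
Unset Printing Implicit Defensive.

Import Order.TTheory GRing.Theory Num.Theory.
Import numFieldNormedType.Exports.

Local Open Scope classical_set_scope.
Local Open Scope ring_scope.

(** * Metric spaces given by a distance function *)

Record metric_axioms (R : realType) (T : choiceType) (d : T -> T -> R) :
  Prop := {
  dist_refl : forall x, d x x = 0;
  dist_eq0 : forall x y, d x y = 0 -> x = y;
  dist_sym : forall x y, d x y = d y x;
  dist_triangle : forall y x z, d x z <= d x y + d y z }.

(** A name for [T] to which the metric structure given by [d] can be attached;
    the proof [dP] is an argument so that the structure is found by
    unification. *)
Definition metrized (R : realType) (T : choiceType) (d : T -> T -> R)
  (dP : metric_axioms d) : Type := T.

Section Metrized.
Variables (R : realType) (T : choiceType) (d : T -> T -> R).
Hypothesis dP : metric_axioms d.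

HB.instance Definition _ := Choice.copy (metrized dP) T.
HB.instance Definition _ := isMetric.Build R (metrized dP)
  (dist_refl dP) (dist_eq0 dP) (dist_sym dP) (dist_triangle dP).

End Metrized.

(** The triangle inequality is automatic here: the sum of two nonzero distances
    is at least [m *+ 2], which bounds the third one. *)
Lemma metric_axioms_pinched (R : realType) (T : choiceType) (d : T -> T -> R)
    (m : R) : 0 < m -> (forall x, d x x = 0) -> (forall x y, d x y = d y x) ->
  (forall x y, x != y -> m <= d x y <= m *+ 2) -> metric_axioms d.
Proof.
move=> m0 d0 dC dm; split=> //.
- move=> x y dxy; apply/eqP; apply: contraT => /dm /andP[+ _].
  by rewrite dxy leNgt m0.
- move=> y x z.
  have d_ge0 a b : 0 <= d a b.
    by have [->|/dm/andP[+ _]] := eqVneq a b; [rewrite d0|apply: le_trans;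
      apply: ltW].
  have [->|xy] := eqVneq x y; first by rewrite d0 add0r.
  have [->|yz] := eqVneq y z; first by rewrite d0 addr0.
  have [->|xz] := eqVneq x z; first by rewrite d0 addr_ge0.
  move: (dm _ _ xy) (dm _ _ yz) (dm _ _ xz).
  move=> /andP[? _] /andP[? _] /andP[_ xzm].
  by rewrite (le_trans xzm)// mulr2n lerD.
Qed.

Section ClusterSpace.
Variables (R : realType) (delta e : R).

(** Three infinite clusters with all distances [delta], except that the first
    and the second cluster are at distance [e] of each other. The third one is
    the hub: its union with either of the other two is again a clique. *)
Definition cluster_dist (x y : nat + nat + nat) : R :=
  if x == y then 0 else
  match x, y with
  | inl (inl _), inl (inr _) | inl (inr _), inl (inl _) => e
  | _, _ => delta
  end.

Lemma cluster_metric : 0 < delta -> 0 < e ->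
  e <= delta *+ 2 -> delta <= e *+ 2 -> metric_axioms cluster_dist.
Proof.
move=> d0 e0 ed de; apply: (@metric_axioms_pinched _ _ _ (Num.min delta e)).
- by rewrite lt_min d0.
- by move=> x; rewrite /cluster_dist eqxx.
- by move=> x y; rewrite /cluster_dist eq_sym; case: x y => [[]|] ? [[]|] ?.
- move=> x y; rewrite /cluster_dist => /negbTE ->.
  rewrite !mulr2n in ed de *; have := (minElt delta e).
  by case: x y => [[]|] ? [[]|] ?; rewrite minElt; case: ifP => ?; lra.
Qed.

End ClusterSpace.

Section CloneSpace.
Variables (R : realType) (U : metricType R) (I : countType) (p : I -> U).
Variables (u : U) (delta : R).

(** Infinitely many clones of [u] over the points [p i]: each has the distances
    of [u] to them, and two clones are at distance [delta]. *)
Definition clone_dist (x y : I + nat) : R :=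
  match x, y with
  | inl i, inl j => mdist (p i) (p j)
  | inl i, inr _ | inr _, inl i => mdist (p i) u
  | inr k, inr l => if k == l then 0 else delta
  end.

Lemma clone_metric : injective p -> 0 < delta ->
  (forall i, delta <= mdist (p i) u) -> metric_axioms clone_dist.
Proof.
move=> p_inj d0 dpu.
split.
- by case=> [i|k] /=; rewrite ?mdistxx ?eqxx.
- case=> [i|k] [j|l] //=.
  + by move=> /mdist_positivity/p_inj ->.
  + by move=> pu; have := dpu i; rewrite pu leNgt d0.
  + by move=> pu; have := dpu j; rewrite pu leNgt d0.
  + by case: eqP => [->//|_ d_eq0]; rewrite d_eq0 ltxx in d0.
- by case=> [i|k] [j|l] //=; rewrite 1?metric_sym 1?eq_sym.
- case=> [j|l] [i|k] [i'|k'] /=.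
  + exact: metric_triangle.
  + exact: metric_triangle.
  + by rewrite addrC [mdist (p j) (p _)]metric_sym; exact: metric_triangle.
  + case: eqP => _; first by rewrite addr_ge0 ?mdist_ge0.
    by rewrite (le_trans (dpu j))// lerDl mdist_ge0.
  + by rewrite [mdist (p i') _]metric_sym; apply: metric_triangle.
  + by rewrite lerDl; case: ifP => // _; rewrite ltW.
  + by rewrite lerDr; case: ifP => // _; rewrite ltW.
  + case: (eqVneq k k') => [_|kk']; first by rewrite addr_ge0//;
      case: ifP => // _; rewrite ltW.
    case: (eqVneq k l) => [<-|_]; first by rewrite (negbTE kk') add0r.
    by rewrite lerDl; case: ifP => // _; rewrite ltW.
Qed.

End CloneSpace.

(** * Distance sets and the Urysohn space *)

(** Addition may leave a truncated semigroup, but only through its upper end. *)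
Lemma distance_set_multiples (R : realType) (Delta : set R) :
  distance_set Delta -> Delta 0 /\
  forall (x y : R) (n : nat),
    Delta x -> Delta y -> x *+ n <= y -> Delta (x *+ n).
Proof.
have mulS (S : set R) x n : distance_semigroup S -> S x -> S (x *+ n).
  by move=> [_ _ S0 SD] Sx; elim: n => [|n IH]; rewrite ?mulr0n// mulrS;
    apply: SD.
case=> [DS|[S [r [SS Sr ->]]]].
  have [_ _ D0 _] := DS; split=> // x y n Dx _ _; exact: mulS.
have [_ S0 SO _] := SS; split.
  by split=> //=; rewrite in_itv/= lexx/=; exact: S0.
move=> x y n [Sx _] [Sy]; rewrite /= in_itv/= => /andP[_ yr] xny.
split; first exact: mulS.
by rewrite /= in_itv/= mulrn_wge0 ?(S0 _ Sx)//= (le_trans xny).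
Qed.

Section Urysohn.
Variables (R : realType) (Delta : set R) (U : metricType R).
Hypothesis hU : urysohn_space Delta U.

Lemma urysohn_realizes (T : countType) (d : T -> T -> R) :
  metric_axioms d -> (forall x y, Delta (d x y)) ->
  exists h : T -> U, forall x y, mdist (h x) (h y) = d x y.
Proof.
move=> dP dD; have [_ _ _ univ] := hU.
have [h hi] := univ (metrized dP) (countableP _) dD.
by exists h => x y; apply: hi.
Qed.

(** Ultrahomogeneity for indexed tuples of points: [p i] determines [q i], even
    when [p] has repetitions, since distance zero is transported as well. *)
Lemma urysohn_homogeneous (I : finType) (p q : I -> U) :
  (forall i j, mdist (q i) (q j) = mdist (p i) (p j)) ->
  exists g : isom U, forall i, g (p i) = q i.
Proof.
move=> pq; have [_ _ homog _] := hU.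
pose f x := if pselect (exists i, p i = x) is left h then q (projT1 (cid h))
  else x.
have fp i : f (p i) = q i.
  rewrite /f; case: pselect => [h|[]]; last by exists i.
  apply: mdist_positivity; rewrite pq; case: cid => j /= ->; exact: mdistxx.
have [||||g gf] := homog (range p) (range q) f.
- exact: finite_image.
- exact: finite_image.
- split.
  + by move=> _ /= [i _ <-]; rewrite fp; exists i.
  + move=> _ _ /set_mem[i _ <-] /set_mem[j _ <-]; rewrite !fp => qij.
    by apply: mdist_positivity; rewrite -pq qij mdistxx.
  + by move=> _ /= [i _ <-]; exists (p i) => //; exists i.
- by move=> _ _ [i _ <-] [j _ <-]; rewrite !fp.
by exists g => i; rewrite gf ?fp//; exists i.
Qed.

End Urysohn.

(** * Averages of equicorrelated events *)

Section Averages.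
Context (d : measure_display) (T : measurableType d) (R : realType).
Variable mu : probability T R.
Implicit Types (E F : (set T)^nat) (C : set T).

Definition prob (A : set T) : R := fine (mu A).

Lemma EFin_prob A : measurable A -> (prob A)%:E = mu A.
Proof. by move=> mA; rewrite /prob fineK// fin_num_measure. Qed.

Lemma prob_ge0 A : 0 <= prob A.
Proof. exact: fine_ge0. Qed.

Lemma prob_le1 A : measurable A -> prob A <= 1.
Proof. by move=> mA; rewrite -lee_fin EFin_prob ?probability_le1. Qed.

Lemma integral_sqr_comb (K : finType) (A : K -> set T) (t : K -> R) :
  (forall k, measurable (A k)) ->
  (\int[mu]_x ((\sum_k t k * \1_(A k) x) ^+ 2)%:E =
   (\sum_k \sum_l t k * t l * prob (A k `&` A l))%:E)%E.
Proof.
move=> mA.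
have mAI k l : measurable (A k `&` A l) by exact: measurableI.
have iA k l : mu.-integrable setT
    (fun x => (t k * t l)%:E * (\1_(A k `&` A l) x)%:E)%E.
  by apply: integrableZl => //; exact: integrable_indic.
transitivity (\int[mu]_x (\sum_k \sum_l
    ((t k * t l)%:E * (\1_(A k `&` A l) x)%:E)))%E.
  apply: eq_integral => x _; rewrite expr2 mulr_suml -sumEFin.
  apply: eq_bigr => k _; rewrite mulr_sumr -sumEFin; apply: eq_bigr => l _.
  by rewrite indicI /= mulrACA.
rewrite integral_sum//; last by move=> k; exact: integrable_sum.
rewrite -sumEFin; apply: eq_bigr => k _.
rewrite integral_sum// -sumEFin; apply: eq_bigr => l _.
rewrite integralZl//; last exact: integrable_indic.
by rewrite integral_indic// setIT [RHS]EFinM EFin_prob.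
Qed.

Lemma sqr_comb_ge0 (K : finType) (A : K -> set T) (t : K -> R) :
  (forall k, measurable (A k)) ->
  0 <= \sum_k \sum_l t k * t l * prob (A k `&` A l).
Proof.
move=> mA; rewrite -lee_fin -integral_sqr_comb//.
by apply: integral_ge0 => x _; rewrite lee_fin sqr_ge0.
Qed.

Definition avg E n (x : T) : R := n%:R^-1 * \sum_(i < n) \1_(E i) x.

(** The powers of 4 make the sequence of averages converge almost everywhere:
    its consecutive differences have geometrically decreasing L1 norms. The
    superior limit gives a measurable function defined at every point, so that
    an isometry transforms it without exceptional sets. *)
Definition avg_lim E (x : T) : \bar R :=
  limn_esup (fun k => (avg E (4 ^ k) x)%:E).

(** Exchangeability up to second moments: [p] is the common probability of the
    events, [c] that of the intersection of two of them. *)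
Definition equicorrelated p c E := forall i j,
  prob (E i `&` E j) = if i == j then p else c.

Lemma sum_diag n (p c : R) :
  \sum_(i < n) \sum_(j < n) (if i == j then p else c) =
  n%:R * (p - c) + n%:R ^+ 2 * c.
Proof.
transitivity (\sum_(i < n) ((p - c) + n%:R * c)).
  apply: eq_bigr => i _.
  transitivity (\sum_(j < n) ((if i == j then p - c else 0) + c)).
    by apply: eq_bigr => j _; case: eqP => _; rewrite ?subrK ?add0r.
  rewrite big_split/= sumr_const card_ord -big_mkcond/= (big_pred1 i);
    last first.
    by move=> j; rewrite eq_sym.
  by rewrite mulr_natl.
rewrite sumr_const card_ord -[LHS]mulr_natl; ring.
Qed.

(** Expanding the square, the contributions of [c] cancel up to the diagonal
    terms of the two averages, which are divided by [n] and [m]. The cross terms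
    enter with a minus sign, so a lower bound on them suffices; this admits
    sequences [E] and [F] with events in common, and in particular [F = E]. *)
Lemma integral_sqr_avgB E F n m p c :
  (forall i, measurable (E i)) -> (forall i, measurable (F i)) ->
  equicorrelated p c E -> equicorrelated p c F ->
  (forall i j, c <= prob (E i `&` F j)) -> (0 < n)%N -> (0 < m)%N ->
  (\int[mu]_x ((avg E n x - avg F m x) ^+ 2)%:E <= (n%:R^-1 + m%:R^-1)%:E)%E.
Proof.
move=> mE mF cE cF cEF n0 m0.
have n0' : n%:R != 0 :> R by rewrite pnatr_eq0 -lt0n.
have m0' : m%:R != 0 :> R by rewrite pnatr_eq0 -lt0n.
pose A (k : 'I_n + 'I_m) := match k with inl i => E i | inr j => F j end.
pose t (k : 'I_n + 'I_m) : R :=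
  match k with inl i => n%:R^-1 | inr j => - m%:R^-1 end.
have mA k : measurable (A k) by case: k => k; [exact: mE|exact: mF].
rewrite (_ : (fun x => _) = fun x => ((\sum_k t k * \1_(A k) x) ^+ 2)%:E);
  last first.
  apply/funext => x; rewrite big_sumType/= -!mulr_sumr mulNr.
  by rewrite /avg.
rewrite integral_sqr_comb// lee_fin big_sumType/=.
have -> : \sum_(i < n) \sum_l t (inl i) * t l * prob (A (inl i) `&` A l) =
  (n%:R * (p - c) + n%:R ^+ 2 * c) * n%:R^-1 ^+2 -
   n%:R^-1 * m%:R^-1 * \sum_(i < n) \sum_(j < m) prob (E i `&` F j).
  rewrite -sum_diag mulr_suml mulr_sumr -sumrB.
  apply: eq_bigr => i _; rewrite big_sumType/= mulr_suml mulr_sumr -sumrN.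
  congr (_ + _); apply: eq_bigr => j _.
    by rewrite cE expr2 mulrC.
  by rewrite mulrN mulNr.
have -> : \sum_(i < m) \sum_l t (inr i) * t l * prob (A (inr i) `&` A l) =
  (m%:R * (p - c) + m%:R ^+ 2 * c) * m%:R^-1 ^+2 -
   n%:R^-1 * m%:R^-1 * \sum_(i < n) \sum_(j < m) prob (E i `&` F j).
  rewrite [X in _ = _ - _ * X]exchange_big/= -sum_diag mulr_suml mulr_sumr
    -sumrB.
  apply: eq_bigr => i _; rewrite big_sumType/= mulr_suml mulr_sumr -sumrN addrC.
  congr (_ + _); apply: eq_bigr => j _.
    by rewrite cF expr2 mulrC mulrNN.
  by rewrite setIC mulNr mulNr [m%:R^-1 * _]mulrC.
set X := \sum_(i < n) _.
have cX : n%:R * m%:R * c <= X.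
  rewrite (_ : _ * c = \sum_(i < n) \sum_(j < m) c).
    by apply: ler_sum => i _; apply: ler_sum => j _.
  by rewrite !sumr_const !card_ord -[RHS]mulr_natl -[c *+ m]mulr_natl mulrA.
have cX' : c <= n%:R^-1 * m%:R^-1 * X.
  by rewrite -invfM mulrC ler_pdivlMr ?mulr_gt0 ?ltr0n// mulrC.
have -> : (n%:R * (p - c) + n%:R ^+ 2 * c) * n%:R^-1 ^+ 2 =
    n%:R^-1 * (p - c) + c.
  by field.
have -> : (m%:R * (p - c) + m%:R ^+ 2 * c) * m%:R^-1 ^+ 2 =
    m%:R^-1 * (p - c) + c.
  by field.
have p1 : p <= 1.
  by have := cE 0 0; rewrite eqxx => <-; apply: prob_le1; exact: measurableI.
have c0 : 0 <= c by have := cE 0 1; rewrite /= => <-; exact: prob_ge0.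
have pc : p - c <= 1 by lra.
have ni : 0 <= n%:R^-1 :> R by rewrite invr_ge0.
have mi : 0 <= m%:R^-1 :> R by rewrite invr_ge0.
have := ler_piMr ni pc; have := ler_piMr mi pc; lra.
Qed.

Lemma measurable_avg E n : (forall i, measurable (E i)) ->
  measurable_fun setT (avg E n).
Proof.
move=> mE; apply: measurable_funM => //; apply: measurable_sum => i.
exact: measurable_indic.
Qed.

Lemma measurable_avg_lim E : (forall i, measurable (E i)) ->
  measurable_fun setT (avg_lim E).
Proof.
move=> mE; apply: measurable_fun_limn_esup => k.
by apply/measurable_EFinP; exact: measurable_avg.
Qed.

Lemma avg_ge0 E n x : 0 <= avg E n x.
Proof. by rewrite mulr_ge0 ?invr_ge0// sumr_ge0. Qed.

Lemma avg_le1 E n x : avg E n x <= 1.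
Proof.
case: n => [|n]; first by rewrite /avg invr0 mul0r.
rewrite /avg mulrC ler_pdivrMr// mul1r -[n.+1 in leRHS]card_ord.
rewrite -sumr_const; apply: ler_sum => i _.
by rewrite indicE; case: (_ \in _).
Qed.

(** From L2 to L1 by [|w| <= a + w ^ 2 / a], where [a = 2 ^ - k] balances the
    two terms. *)
Lemma integral_norm_avgB E F k n m p c :
  (forall i, measurable (E i)) -> (forall i, measurable (F i)) ->
  equicorrelated p c E -> equicorrelated p c F ->
  (forall i j, c <= prob (E i `&` F j)) ->
  (4 ^ k <= n)%N -> (4 ^ k <= m)%N ->
  (\int[mu]_x `|avg E n x - avg F m x|%:E <= (3 * (2^-1) ^+ k)%:E)%E.
Proof.
move=> mE mF cE cF cEF kn km.
have k0 : (0 < 4 ^ k)%N by rewrite expn_gt0.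
have n0 := leq_trans k0 kn; have m0 := leq_trans k0 km.
have mW : measurable_fun setT (fun x => avg E n x - avg F m x).
  by apply: measurable_funB; exact: measurable_avg.
set a : R := 2^-1 ^+ k.
have a0 : 0 < a by rewrite exprn_gt0.
have E4 N : (4 ^ k <= N)%N -> N%:R^-1 <= a ^+ 2.
  move=> kN; rewrite /a -exprM mulnC exprM exprVn -natrX.
  rewrite exprVn -natrX lef_pV2 ?posrE ?ltr0n ?ler_nat//.
  exact: leq_trans kN.
apply: (@le_trans _ _
  (\int[mu]_x (a%:E + a^-1%:E * ((avg E n x - avg F m x)^+2)%:E))%E).
  apply: ge0_le_integral => //.
  - by apply/measurable_EFinP; exact: measurableT_comp.
  - apply/measurable_EFinP; apply: measurable_funD => //.
    by apply: measurable_funM => //; exact: measurable_funX.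
  - move=> x _; rewrite -EFinM -EFinD lee_fin.
    set w := avg E n x - _; rewrite -[w ^+ 2]real_normK ?num_real//.
    have : 0 <= a^-1 * (a - `|w|) ^+ 2.
      by rewrite mulr_ge0 ?sqr_ge0 ?invr_ge0 ?ltW.
    have -> : a^-1 * (a - `|w|) ^+ 2 = a - `|w| *+ 2 + a^-1 * `|w| ^+ 2.
      by field; rewrite gt_eqF.
    have : 0 <= `|w| by [].
    rewrite mulr2n; lra.
have m2 : measurable_fun setT (fun x => ((avg E n x - avg F m x)^+2)%:E).
  by apply/measurable_EFinP; exact: measurable_funX.
rewrite ge0_integralD//; first last.
- by apply: measurable_funeM.
- by move=> x _; rewrite -EFinM lee_fin mulr_ge0 ?sqr_ge0 ?invr_ge0 ?ltW.
- by move=> x _; rewrite lee_fin ltW.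
rewrite integral_cst// ge0_integralZl//; first last.
- by rewrite lee_fin invr_ge0 ltW.
- by move=> x _; rewrite lee_fin sqr_ge0.
rewrite /= probability_setT mule1.
apply: (@le_trans _ _ (a%:E + a^-1%:E * (n%:R^-1 + m%:R^-1)%:E)%E).
  rewrite leeD2l// lee_wpmul2l//; first by rewrite lee_fin invr_ge0 ltW.
  exact: (integral_sqr_avgB mE mF cE cF).
rewrite -EFinM -EFinD lee_fin.
have : a^-1 * (n%:R^-1 + m%:R^-1) <= a^-1 * (a ^+ 2 + a ^+ 2).
  by rewrite ler_wpM2l ?invr_ge0 ?(ltW a0)// lerD// E4.
have -> : a^-1 * (a ^+ 2 + a ^+ 2) = a + a by field; rewrite gt_eqF.
lra.
Qed.

(** The sum of the [|W k|] has finite integral by monotone convergence, hence is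
    finite almost everywhere. *)
Lemma ae_cvg_series (W : nat -> T -> R) (M : R) :
  (forall k, measurable_fun setT (W k)) ->
  (forall k, (\int[mu]_x `|W k x|%:E <= (M * 2^-1 ^+ k)%:E)%E) ->
  {ae mu, forall x, cvgn (series (fun k => W k x))}.
Proof.
move=> mW WM.
have mWe k : measurable_fun setT (fun x => `|W k x|%:E).
  by apply/measurable_EFinP; exact: measurableT_comp.
have M0 : 0 <= M.
  have := WM 0; rewrite expr0 mulr1 -lee_fin; apply: le_trans.
  by apply: integral_ge0.
have : mu.-integrable setT (fun x => \sum_(k <oo) `|W k x|%:E)%E.
  apply/integrableP; split; first exact: ge0_emeasurable_sum.
  rewrite (eq_integral (fun x => \sum_(k <oo) `|W k x|%:E))%E; last first.
    by move=> x _; rewrite gee0_abs// nneseries_ge0.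
  rewrite integral_nneseries//.
  apply: (@le_lt_trans _ _ (\sum_(k <oo) (M * 2^-1 ^+ k)%:E)%E).
    by apply: lee_nneseries => // k _ _; exact: integral_ge0.
  suff -> : (\sum_(k <oo) (M * 2^-1 ^+ k)%:E = (M * (1 - 2^-1)^-1)%:E)%E.
    by rewrite ltry.
  apply/cvg_lim => //; apply: cvg_EFin.
    by apply: nearW => n; rewrite sumEFin.
  rewrite (_ : _ \o _ = series (geometric M 2^-1)); last first.
    by apply/funext => n /=; rewrite sumEFin.
  by apply: cvg_geometric_series; rewrite ger0_norm; lra.
move=> /(integrable_ae measurableT); apply: filterS => x /(_ I) Sx.
apply: normed_cvg; apply/cvg_ex.
exists (fine (\sum_(k <oo) `|W k x|%:E)%E).
have : ((\sum_(0 <= k < n) `|W k x|%:E)%E @[n --> \oo] -->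
    (\sum_(k <oo) `|W k x|%:E)%E).
  exact: is_cvg_nneseries.
rewrite -{1}(fineK Sx) => /fine_cvgP[_].
apply: cvg_trans; apply: near_eq_cvg; near=> n => /=.
by rewrite sumEFin.
Unshelve. all: by end_near. Qed.

End Averages.
Arguments avg {d T R}.
Arguments avg_lim {d T R}.

Lemma cvg_telescope (R : realType) (u : R ^nat) :
  cvgn (series (telescope u)) -> cvgn u.
Proof.
rewrite telescopeK => /cvg_ex[/= l ul]; apply/cvg_ex; exists (l + u 0).
rewrite [X in X @ _ --> _](_ : _ = (fun k => (u k - u 0) + u 0)).
  by apply: cvgD => //; exact: cvg_cst.
by apply/funext => k; rewrite subrK.
Qed.

Section Limit.
Context (d : measure_display) (T : measurableType d) (R : realType).
Variable mu : probability T R.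
Implicit Types (E F : (set T)^nat) (C : set T).

Lemma equicorrelated_le p c E : (forall i, measurable (E i)) ->
  equicorrelated mu p c E -> forall i j, c <= prob mu (E i `&` E j).
Proof.
move=> mE cE i j; rewrite cE; case: eqP => // _.
have := cE 0 0; have := cE 0 1; rewrite /= => <- <-.
rewrite -lee_fin !EFin_prob; try exact: measurableI.
rewrite setIid; apply: le_measure; rewrite ?inE//; exact: measurableI.
Qed.

(** The increments of the averages form an almost everywhere convergent
    series. *)
Lemma ae_avg_lim p c E : (forall i, measurable (E i)) ->
  equicorrelated mu p c E ->
  {ae mu, forall x,
     ((avg E (4 ^ k) x)%:E : \bar R) @[k --> \oo] --> avg_lim E x}.
Proof.
move=> mE cE.
pose W k x : R := avg E (4 ^ k.+1) x - avg E (4 ^ k) x.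
have mW k : measurable_fun setT (W k).
  by apply: measurable_funB; exact: measurable_avg.
have WM k : (\int[mu]_x `|W k x|%:E <= (3 * 2^-1 ^+ k)%:E)%E.
  apply: (integral_norm_avgB mE mE cE cE) => //.
  - exact: equicorrelated_le.
  - by rewrite leq_exp2l.
apply: filterS (ae_cvg_series mW WM) => x Wx.
have /cvg_ex[l ul] := cvg_telescope (u := fun k => avg E (4 ^ k) x) Wx.
have ule : ((avg E (4 ^ k) x)%:E : \bar R) @[k --> \oo] --> l%:E.
  by apply: cvg_EFin => //; exact: nearW.
rewrite /avg_lim is_cvg_limn_esupE; first by rewrite (cvg_lim _ ule).
by apply/cvg_ex; exists l%:E.
Qed.

(** Two sequences with the same [p] and [c] whose mutual correlations are not
    smaller than [c] have averages that are close in L2: the limit is canonical.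
    This is what makes it invariant under isometries. *)
Lemma ae_avg_lim_eq p c E F : (forall i, measurable (E i)) ->
  (forall i, measurable (F i)) ->
  equicorrelated mu p c E -> equicorrelated mu p c F ->
  (forall i j, c <= prob mu (E i `&` F j)) ->
  {ae mu, forall x, avg_lim E x = avg_lim F x :> \bar R}.
Proof.
move=> mE mF cE cF cEF.
pose W k x : R := avg E (4 ^ k) x - avg F (4 ^ k) x.
have mW k : measurable_fun setT (W k).
  by apply: measurable_funB; exact: measurable_avg.
have WM k : (\int[mu]_x `|W k x|%:E <= (3 * 2^-1 ^+ k)%:E)%E.
  exact: (integral_norm_avgB mE mF cE cF).
have := ae_cvg_series mW WM;
  apply: filterS3 (ae_avg_lim mE cE) (ae_avg_lim mF cF).
move=> x Ex Fx /cvg_series_cvg_0 W0.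
apply/esym; apply: cvg_unique Ex => //.
rewrite (_ : (fun k => (avg E _ x)%:E) =
  (fun k => (avg F (4 ^ k) x)%:E + (W k x)%:E)%E); last first.
  by apply/funext => k; rewrite -EFinD addrC subrK.
rewrite -[avg_lim F x]adde0; apply: cvgeD => //.
  by rewrite fin_num_adde_defl.
by apply: cvg_EFin => //; exact: nearW.
Qed.

Lemma integral_avg E C n q : (forall i, measurable (E i)) -> measurable C ->
  (forall i, prob mu (E i `&` C) = q) -> (0 < n)%N ->
  (\int[mu]_(x in C) (avg E n x)%:E = q%:E)%E.
Proof.
move=> mE mC EC n0.
have mI i : measurable_fun C (fun x => (\1_(E i) x : R)%:E).
  by apply/measurable_EFinP; exact: measurable_indic.
transitivity (\int[mu]_(x in C) (n%:R^-1%:E * \sum_(i < n) (\1_(E i) x)%:E))%E.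
  by apply: eq_integral => x _; rewrite /avg EFinM sumEFin.
rewrite ge0_integralZl//; first last.
- by move=> x _; apply: sume_ge0.
- exact: emeasurable_sum.
rewrite ge0_integral_sum// (eq_bigr (fun=> q%:E)); last first.
  move=> i _; rewrite integral_indic// -(EC i) EFin_prob//.
  exact: measurableI.
rewrite sumEFin -EFinM sumr_const card_ord -[q *+ n]mulr_natl mulKf//.
by rewrite pnatr_eq0 -lt0n.
Qed.

(** Dominated convergence, the integrals of the averages over [C] being
    constant. *)
Lemma integral_avg_lim p c E C q : (forall i, measurable (E i)) ->
  equicorrelated mu p c E -> measurable C ->
  (forall i, prob mu (E i `&` C) = q) ->
  mu.-integrable C (avg_lim E) /\ (\int[mu]_(x in C) avg_lim E x = q%:E)%E.
Proof.
move=> mE cE mC EC.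
have [||||| intl _ cvgl] := @dominated_convergence _ _ _ mu C mC
  (fun k x => (avg E (4 ^ k) x)%:E) (avg_lim E) (cst 1%E).
- move=> k; apply/measurable_EFinP; apply: measurable_funTS;
    exact: measurable_avg.
- by apply: measurable_funTS; exact: measurable_avg_lim.
- by have := ae_avg_lim mE cE; apply: filterS.
- exact: finite_measure_integrable_cst.
- by apply: nearW => x k _; rewrite lee_fin ger0_norm ?avg_ge0// avg_le1.
split=> //; apply/esym; apply: cvg_unique cvgl => //.
rewrite (_ : [sequence _]_n = cst q%:E); first exact: cvg_cst.
by apply/funext => k /=; rewrite (integral_avg mE mC EC)// expn_gt0.
Qed.

(** The limit has mean [p]. Under the zero-one hypothesis it lies almost
    everywhere on one side of its mean, so it is almost everywhere equal to [p],
    and its integral [q] over [C] is [p * prob mu C]. *)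
Lemma zero_one_independent p c E C q : (forall i, measurable (E i)) ->
  equicorrelated mu p c E -> measurable C ->
  (forall i, prob mu (E i `&` C) = q) ->
  mu [set x | (avg_lim E x < p%:E)%E] = 0%E \/
  mu [set x | (avg_lim E x < p%:E)%E] = 1%E ->
  q = p * prob mu C.
Proof.
move=> mE cE mC EC S01.
have [||iT ET] := @integral_avg_lim p c E setT p mE cE => //.
  by move=> i; rewrite setIT -(setIid (E i)) cE eqxx.
have [_ iC] := integral_avg_lim mE cE mC EC.
have mL : measurable_fun setT (avg_lim E : T -> \bar R).
  exact: measurable_avg_lim.
have mS : measurable [set x | (avg_lim E x < p%:E)%E].
  rewrite -[X in measurable X]setTI; exact: emeasurable_fun_infty_o.
have ip : mu.-integrable setT (cst p%:E : T -> \bar R).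
  exact: finite_measure_integrable_cst.
have mf : measurable_fun setT (fun x => avg_lim E x - p%:E)%E.
  by apply: emeasurable_funB.
have mfN : measurable_fun setT (fun x => p%:E - avg_lim E x)%E.
  by apply: emeasurable_funB.
have f0 : (\int[mu]_x (avg_lim E x - p%:E) = 0)%E.
  by rewrite integralB//= ET integral_cst//= probability_setT mule1 subee.
have f0N : (\int[mu]_x (p%:E - avg_lim E x) = 0)%E.
  by rewrite integralB//= ET integral_cst//= probability_setT mule1 subee.
have abs0 : (\int[mu]_x `|avg_lim E x - p%:E| = 0)%E.
  case: S01 => S01.
    rewrite -[RHS]f0; apply: ae_eq_integral => //;
      first exact: measurableT_comp.
    exists [set x | (avg_lim E x < p%:E)%E]; split => // x /= nx.
    rewrite ltNge; apply/negP => px; apply: nx => _.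
    by rewrite gee0_abs//; move: px; rewrite -sube_ge0.
  rewrite -[RHS]f0N; apply: ae_eq_integral => //; first exact: measurableT_comp.
  exists (~` [set x | (avg_lim E x < p%:E)%E]); split.
  - exact: measurableC.
  - by rewrite -(subee (x := 1%E))// -{2}S01; exact: probability_setC.
  - move=> x nx px; apply: nx => _.
    rewrite lee0_abs ?sube_le0 ?(ltW px)// fin_num_oppeB//.
    by rewrite addeC.
have aeL : ae_eq mu setT (fun x => avg_lim E x - p%:E)%E (cst 0%E).
  exact/ae_eq_integral_abs.
apply: EFin_inj; rewrite -iC (@ae_eq_integral _ _ _ _ _ (cst p%:E))//.
- by rewrite integral_cst// EFinM EFin_prob.
- by apply: measurable_funTS; exact: mL.
- apply: filterS aeL => x Lx _; rewrite -[LHS](@subeK _ _ p%:E)//.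
  by rewrite (Lx I) add0e.
Qed.

End Limit.

Section Hub.
Context (d : measure_display) (T : measurableType d) (R : realType).
Variable mu : probability T R.

(** In L2, the averages of [A], [B] and [H] tend to [a], [b] and [h] with
    [<a, a> = <b, b> = <h, h> = <a, h> = <b, h> = c] and [<a, b> = c'], so that
    [0 <= |a + b - 2 h| ^ 2 = 2 (c' - c)]. The proof does this with averages of
    [n] terms, up to an error of order [1 / n]. *)
Lemma hub_correlation_le (p c c' : R) (A B H : (set T)^nat) :
  (forall i, measurable (A i)) -> (forall i, measurable (B i)) ->
  (forall i, measurable (H i)) ->
  equicorrelated mu p c A -> equicorrelated mu p c B ->
  equicorrelated mu p c H ->
  (forall i j, prob mu (A i `&` H j) = c) ->
  (forall i j, prob mu (B i `&` H j) = c) ->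
  (forall i j, prob mu (A i `&` B j) = c') -> c <= c'.
Proof.
move=> mA mB mH cA cB cH cAH cBH cAB.
have ineq n : 0 <= n%:R * (6 * (p - c) + n%:R * (2 * (c' - c))).
  (* ineq is n ^ 2 times the inequality 0 <= |a + b - 2 h| ^ 2, where a, b, h
     are averages of n indicators *)
  pose D (k : 'I_n + 'I_n + 'I_n) := match k with
    | inl (inl i) => A i | inl (inr i) => B i | inr i => H i end.
  pose t (k : 'I_n + 'I_n + 'I_n) : R := if k is inl _ then 1 else -2.
  have mD k : measurable (D k).
    by case: k => [[]|] i; [exact: mA|exact: mB|exact: mH].
  have := sqr_comb_ge0 mu t mD.
  pose S (F G : (set T)^nat) := \sum_(i < n) \sum_(j < n) prob mu (F i `&` G j).
  have SC F G : S F G = S G F.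
    by rewrite /S exchange_big; apply: eq_bigr => i _; apply: eq_bigr => j _;
      rewrite setIC.
  have Sdiag F : equicorrelated mu p c F ->
      S F F = n%:R * (p - c) + n%:R ^+ 2 * c.
    by move=> cF; rewrite -sum_diag; apply: eq_bigr => i _;
      apply: eq_bigr => j _; rewrite cF.
  have Scst F G v : (forall i j, prob mu (F i `&` G j) = v) ->
      S F G = n%:R ^+ 2 * v.
    move=> FG; rewrite /S (eq_bigr (fun=> n%:R * v)) => [|i _].
      by rewrite sumr_const card_ord -mulr_natl; ring.
    by rewrite (eq_bigr (fun=> v)) ?sumr_const ?card_ord ?mulr_natl.
  have -> : \sum_k \sum_l t k * t l * prob mu (D k `&` D l) =
     (S A A + S A B - 2 * S A H) + (S B A + S B B - 2 * S B H)
     - 2 * (S H A + S H B - 2 * S H H).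
    have row F a : \sum_l a * t l * prob mu (F `&` D l) =
      a * (\sum_(j < n) prob mu (F `&` A j) + \sum_(j < n) prob mu (F `&` B j)
       - 2 * \sum_(j < n) prob mu (F `&` H j)).
      rewrite !big_sumType/= mulrBr mulrDr [a * (2 * _)]mulrA !mulr_sumr -sumrN.
      congr (_ + _ + _); apply: eq_bigr => j _; ring.
    under eq_bigr do rewrite row.
    rewrite !big_sumType/= -!mulr_sumr !mul1r /S !sumrB !big_split/=
      -!mulr_sumr.
    by rewrite mulNr.
  rewrite (SC B A) (SC H A) (SC H B) (Sdiag A)// (Sdiag B)// (Sdiag H)//.
  rewrite (Scst A B c')// (Scst A H c)// (Scst B H c)//.
  by congr (0 <= _); ring.
rewrite leNgt; apply/negP => cc'.
pose x := 6 * (p - c) / (2 * (c - c')).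
have x0 : 0 < 2 * (c - c') by lra.
have [n nx] : exists n : nat, x < n%:R.
  by exists (Num.bound `|x|); rewrite (le_lt_trans (ler_norm x))// archi_boundP.
have := ineq n.+1; rewrite pmulr_rge0//.
have : x < n.+1%:R by rewrite (lt_trans nx)// ltr_nat.
rewrite ltr_pdivrMr//; lra.
Qed.

End Hub.

(** * Coordinates and the shift *)

Section Coordinates.
Variables (R : realType) (U : metricType R) (dZ : measure_display).
Variable Z : measurableType dZ.

Definition coord (u : U) (z : power_space U Z) : Z := z u.

Definition event (B : set Z) (u : U) : set (power_space U Z) :=
  [set z | B (z u)].

Definition box (I : Type) (p : I -> U) (B : I -> set Z) :
  set (power_space U Z) := [set z | forall i, B i (z (p i))].

Lemma measurable_event B u : measurable B -> measurable (event B u).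
Proof.
move=> mB; apply: sub_sigma_algebra; exists u => //.
by exists B => //; rewrite setTI.
Qed.

Lemma measurable_coord u : measurable_fun setT (coord u).
Proof. by move=> _ B mB; rewrite setTI; exact: measurable_event. Qed.

HB.instance Definition _ u := isMeasurableFun.Build _ _ _ _ (coord u)
  (measurable_coord u).

Lemma measurable_box (I : finType) (p : I -> U) (B : I -> set Z) :
  (forall i, measurable (B i)) -> measurable (box p B).
Proof.
move=> mB; rewrite (_ : box p B = \bigcap_(i in [set: I]) event (B i) (p i)).
  by apply: fin_bigcap_measurable => // i _; exact: measurable_event.
by apply/seteqP; split => [z zB i _|z zB i]; [exact: zB|exact: zB].
Qed.

Lemma image_shift (g : isom U) (Y : set (power_space U Z)) :
  Defs.shift g @` Y = [set z | Y (fun u => z (g u))].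
Proof.
apply/seteqP; split => [_ [z Yz <-]|z Yz] /=.
  by rewrite [X in Y X](_ : _ = z)//; apply/funext => u;
    rewrite /Defs.shift isom_funK.
by exists (fun u => z (g u)) => //; apply/funext => u;
  rewrite /Defs.shift isom_invK.
Qed.

Lemma image_shift_box (g : isom U) (I : Type) (p : I -> U) (B : I -> set Z) :
  Defs.shift g @` box p B = box (g \o p) B.
Proof. by rewrite image_shift. Qed.

End Coordinates.

(** * Invariant measures *)

Section Shift.
Variables (R : realType) (Delta : set R) (hDelta : distance_set Delta).
Variables (U : metricType R) (hU : urysohn_space Delta U).
Variables (dZ : measure_display) (Z : measurableType dZ).
Variable mu : probability (power_space U Z) R.
Hypothesis mu_inv : shift_invariant mu.

Let Delta_dist (x y : U) : Delta (mdist x y).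
Proof. by have [_ D _ _] := hU; exact: D. Qed.

(** Ultrahomogeneity and invariance: the law of finitely many coordinates
    depends only on the isometry type of their indices. *)
Lemma box_isometry (I : finType) (p q : I -> U) (B : I -> set Z) :
  (forall i j, mdist (q i) (q j) = mdist (p i) (p j)) ->
  (forall i, measurable (B i)) -> mu (box q B) = mu (box p B).
Proof.
move=> pq mB; have [g gp] := urysohn_homogeneous hU pq.
rewrite -[RHS](mu_inv g) ?image_shift_box; last exact: measurable_box.
by congr (mu (box _ B)); apply/funext => i /=; rewrite gp.
Qed.

Section FixedSet.
Variables (B : set Z) (mB : measurable B).

Definition corr (x y : U) : R := prob mu (event B x `&` event B y).

Lemma corr_isometry x y x' y' :
  mdist x y = mdist x' y' -> corr x y = corr x' y'.
Proof.
move=> xy; pose p a b (c : bool) : U := if c then a else b.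
have corrE a b : corr a b = fine (mu (box (p a b) (fun=> B))).
  congr (fine (mu _)); apply/seteqP; split => [z [za zb] []//|z zp].
  by split; [exact: (zp true)|exact: (zp false)].
rewrite !corrE (@box_isometry _ (p x' y') (p x y))//.
by move=> [] [] /=; rewrite ?mdistxx// metric_sym xy metric_sym.
Qed.

Lemma prob_event x y : prob mu (event B x) = prob mu (event B y).
Proof.
have := @corr_isometry x x y y; rewrite /corr !setIid !mdistxx; exact.
Qed.

(** The cluster space with these two distances embeds in [U]; its hub compares
    the correlations at the two distances. *)
Lemma corr_le x y x' y' : 0 < mdist x y -> 0 < mdist x' y' ->
  mdist x y <= mdist x' y' *+ 2 -> mdist x' y' <= mdist x y *+ 2 ->
  corr x y <= corr x' y'.
Proof.
move=> xy0 xy'0 le1 le2.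
have dD a b : Delta (cluster_dist (mdist x y) (mdist x' y') a b).
  have D0 : Delta 0 by rewrite -(mdistxx x); exact: Delta_dist.
  rewrite /cluster_dist; case: ifP => // _.
  by case: a b => [[]|] ? [[]|] ?; exact: Delta_dist.
have [h hE] := urysohn_realizes hU (cluster_metric xy0 xy'0 le2 le1) dD.
have mE i : measurable (event B (h i)) by exact: measurable_event.
have clique (f : nat -> nat + nat + nat) : injective f ->
    (forall i j, i != j ->
       cluster_dist (mdist x y) (mdist x' y') (f i) (f j) = mdist x y) ->
    equicorrelated mu (prob mu (event B x)) (corr x y)
      (fun i => event B (h (f i))).
  move=> f_inj fd i j; case: eqVneq => [->|ij];
    first by rewrite setIid (prob_event _ x).
  by apply: corr_isometry; rewrite hE fd.
apply: (@hub_correlation_le _ _ _ mu (prob mu (event B x)) _ _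
   (fun i => event B (h (inl (inl i)))) (fun i => event B (h (inl (inr i))))
   (fun i => event B (h (inr i)))) => //.
- by apply: (clique (fun i => inl (inl i))) => [? ? []//|i j ij];
    rewrite /cluster_dist/= ifN.
- by apply: (clique (fun i => inl (inr i))) => [? ? []//|i j ij];
    rewrite /cluster_dist/= ifN.
- by apply: (clique (fun i => inr i)) => [? ? []//|i j ij];
    rewrite /cluster_dist/= ifN.
- by move=> i j; apply: corr_isometry; rewrite hE.
- by move=> i j; apply: corr_isometry; rewrite hE.
- by move=> i j; apply: corr_isometry; rewrite hE.
Qed.

Lemma corr_comparable x y x' y' : 0 < mdist x y -> 0 < mdist x' y' ->
  mdist x y <= mdist x' y' *+ 2 -> mdist x' y' <= mdist x y *+ 2 ->
  corr x y = corr x' y'.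
Proof. by move=> ? ? ? ?; apply/eqP; rewrite eq_le !corr_le. Qed.

Lemma urysohn_pair (t : R) : Delta t -> 0 < t -> exists x y : U, mdist x y = t.
Proof.
have [D0 _] := distance_set_multiples hDelta.
move=> Dt t0; pose dt (a b : bool) := if a == b then 0 else t.
have [||h hE] := @urysohn_realizes _ _ _ hU bool dt.
- apply: (@metric_axioms_pinched _ _ _ t) => //.
  + by move=> a; rewrite /dt eqxx.
  + by move=> a b; rewrite /dt eq_sym.
  + by move=> a b; rewrite /dt => /negbTE ->; rewrite lexx mulr2n lerDl ltW.
- by move=> a b; rewrite /dt; case: ifP.
by exists (h true), (h false); rewrite hE.
Qed.

(** Consecutive multiples [n.+1] and [n.+2] of a distance are within a factor 2
    of each other, so the comparison can be chained. *)
Lemma corr_multiple x y x' y' (e : R) n : 0 < mdist x y -> Delta e ->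
  mdist x y *+ n.+1 <= e -> mdist x' y' = mdist x y *+ n.+1 ->
  corr x y = corr x' y'.
Proof.
move=> xy0 De; elim: n x' y' => [|n IH] x' y' ne xy'.
  by apply: corr_isometry; rewrite xy' mulr1n.
have [_ DM] := distance_set_multiples hDelta.
set t := mdist x y in xy0 ne xy' *.
have ne' : t *+ n.+1 <= e by rewrite (le_trans _ ne)// ler_pMn2l.
have Dt : Delta t by exact: Delta_dist.
have t0 : 0 < t *+ n.+1 by rewrite mulrn_wgt0.
have [a [b ab]] := urysohn_pair (DM _ _ _ Dt De ne') t0.
rewrite (IH a b)//; apply: corr_comparable; rewrite ?ab ?xy'//.
- by rewrite mulrn_wgt0.
- by rewrite -mulrnA ler_pMn2l//; lia.
- by rewrite -mulrnA ler_pMn2l//; lia.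
Qed.

(** The correlation of two coordinates does not depend on their distance: the
    larger distance is within a factor 2 of the last multiple of the smaller one
    below it. *)
Lemma corr_const x y x' y' : x != y -> x' != y' -> corr x y = corr x' y'.
Proof.
rewrite -!mdist_gt0.
wlog le : x y x' y' / mdist x y <= mdist x' y'.
  move=> H; have [/H//|/ltW/H{}H] := leP (mdist x y) (mdist x' y').
  by move=> *; rewrite H.
move=> xy0 xy'0; set t := mdist x y in le xy0; set e := mdist x' y' in le xy'0.
have [_ DM] := distance_set_multiples hDelta.
have [n /andP[tn tn1]] : exists n, t *+ n.+1 <= e < t *+ n.+2.
  exists (Num.truncn (e / t)).-1;
    have et0 : 0 <= e / t by rewrite divr_ge0 ?ltW.
  have /andP[l r] := truncn_itv et0.
  have T0 : (0 < Num.truncn (e / t))%N.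
    rewrite -ltnS -(ltr_nat R); apply: le_lt_trans r.
    by rewrite ler_pdivlMr// mul1r.
  rewrite prednK//; rewrite ler_pdivlMr// in l; rewrite ltr_pdivrMr// in r.
  by rewrite -[t *+ _]mulr_natl l -[t *+ _]mulr_natl.
have Dt : Delta t by exact: Delta_dist.
have De : Delta e by exact: Delta_dist.
have [a [b ab]] := urysohn_pair (DM _ _ _ Dt De tn) (mulrn_wgt0 _ xy0).
rewrite (corr_multiple (e := e) (n := n) (x' := a) (y' := b))//.
apply: corr_comparable; rewrite ?ab ?mulrn_wgt0//.
- by rewrite (le_trans tn)// mulr2n lerDl ltW.
- rewrite -mulrnA (le_trans (ltW tn1))// ler_pMn2l//.
  lia.
Qed.

Hypothesis mu_erg : shift_ergodic mu.

(** An isometry [g] moves the limit along [w] to the limit along [g \o w], which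
    is almost everywhere the same function, because any two distinct points of
    [U] have the same correlation. Ergodicity then applies to the level sets. *)
Lemma zero_one_avg_lim (w : nat -> U) (t : R) : injective w ->
  mu [set z | (avg_lim (fun i => event B (w i)) z < t%:E)%E] = 0%E \/
  mu [set z | (avg_lim (fun i => event B (w i)) z < t%:E)%E] = 1%E.
Proof.
move=> w_inj.
pose S (v : nat -> U) : set (power_space U Z) :=
  [set z | (avg_lim (fun i => event B (v i)) z < t%:E)%E].
have mE (v : nat -> U) i : measurable (event B (v i)).
  exact: measurable_event.
have mS v : measurable (S v).
  rewrite -[S v]setTI; apply: emeasurable_fun_infty_o => //.
  exact: measurable_avg_lim.
apply: (mu_erg (mS w)) => g.
have eqc v : injective v -> equicorrelated mu (prob mu (event B (w 0)))
    (corr (w 0) (w 1)) (fun i => event B (v i)).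
  move=> v_inj i j; case: eqVneq => [->|ij].
    by rewrite setIid; exact: prob_event.
  by apply: corr_const; [rewrite (inj_eq v_inj)|rewrite (inj_eq w_inj)].
have gw_inj : injective (g \o w).
  by apply: inj_comp w_inj; exact: can_inj (@isom_funK _ _ g).
have [|N [mN N0 NE]] :=
  ae_avg_lim_eq (mE w) (mE (g \o w)) (eqc _ w_inj) (eqc _ gw_inj).
  (* the two sequences may share points, whose correlation is then larger *)
  move=> i j; have [wgw|ne] := eqVneq (w i) (g (w j)).
    rewrite /= -wgw setIid.
    have := equicorrelated_le (mE w) (eqc _ w_inj) 0 0.
    by rewrite setIid (prob_event _ (w i)).
  rewrite le_eqVlt; apply/orP; left; apply/eqP.
  by apply: corr_const => //; rewrite (inj_eq w_inj).
(* by definition, event B (w i) pulls back along the shift to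
   event B (g (w i)) *)
have -> : Defs.shift g @` S w = S (g \o w) by exact: image_shift.
apply/eqP; rewrite eq_le measure_ge0 andbT -N0.
apply: le_measure; rewrite ?inE//; first
  by apply: measurableU; exact: measurableD.
move=> z symd; apply: NE => eqz; move: symd.
by rewrite /S /setY /= -eqz => -[[]|[]].
Qed.

End FixedSet.

(** The point [u] is replaced by a sequence of clones of it over the points
    [p i], with the smallest distance from [u] to the [p i] as mutual distance.
    Conditioning on the box does not distinguish the clones, so their averages,
    whose limit is constant, show the independence. *)
Lemma event_box_independent (u : U) (I : finType) (p : I -> U) (B : set Z)
    (C : I -> set Z) : shift_ergodic mu ->
  injective p -> (forall i, p i != u) -> measurable B ->
  (forall i, measurable (C i)) ->
  prob mu (event B u `&` box p C) = prob mu (event B u) * prob mu (box p C).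
Proof.
move=> mu_erg p_inj pu mB mC.
have [[i0 _]|I0] := pselect (exists i0 : I, True); last first.
  have -> : box p C = setT.
    by apply/seteqP; split => // z _ i; case: I0; exists i.
  by rewrite setIT /prob probability_setT mulr1.
pose delta := mdist (p [arg min_(i < i0) mdist (p i) u]%O) u.
have [delta_gt0 Ddelta delta_min] : [/\ 0 < delta, Delta delta &
    forall i, delta <= mdist (p i) u].
  split; [by rewrite mdist_gt0|exact: Delta_dist|].
  by rewrite /delta => i; case: arg_minP => // j _; exact.
have dD a b : Delta (clone_dist p u delta a b).
  have D0 : Delta 0 by rewrite -(mdistxx u); exact: Delta_dist.
  by case: a b => [i|k] [j|l] //=; case: ifP.
have [h hE] := urysohn_realizes hU (clone_metric p_inj delta_gt0 delta_min) dD.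
pose w k := h (inr k).
have w_inj : injective w.
  move=> k l wkl; have := hE (inr k) (inr l).
  rewrite -/(w k) wkl mdistxx /=; case: eqVneq => // _ d0.
  by rewrite -d0 ltxx in delta_gt0.
pose ps (k : option I) := if k is Some i then p i else u.
pose qs n (k : option I) := if k is Some i then h (inl i) else w n.
have pq n k l : mdist (qs n k) (qs n l) = mdist (ps k) (ps l).
  case: k l => [i|] [j|]; rewrite /= /w ?hE /= ?eqxx ?mdistxx//.
  exact: metric_sym.
pose D A (k : option I) := if k is Some i then C i else A.
have mD A k : measurable A -> measurable (D A k).
  by case: k => [i|] //= _; exact: mC.
have boxE n (A : set Z) : measurable A ->
    prob mu (event A (w n) `&` box (h \o inl) C) =
    prob mu (event A u `&` box p C).
  move=> mA.
  have E v q : event A v `&` box q C =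
    box (fun k : option I => if k is Some i then q i else v) (D A).
    apply/seteqP; split => [z [zA zC]|z zD].
      by case=> [i|]; [exact: zC|exact: zA].
    by split => [|i]; [exact: (zD None)|exact: (zD (Some i))].
  rewrite /prob !E (box_isometry (p := ps) (q := qs n))// => k; exact: mD.
have boxC : prob mu (box (h \o inl) C) = prob mu (box p C).
  have := boxE 0 setT measurableT.
  have eT v : event setT v = setT by apply/seteqP; split.
  by rewrite !eT !setTI.
rewrite -(boxE 0 B)// -boxC.
rewrite (prob_event mB u (w 0)).
apply: (@zero_one_independent _ _ _ mu _ (corr B (w 0) (w 1))
  (fun i => event B (w i))).
- by move=> i; exact: measurable_event.
- move=> i j; case: eqVneq => [->|ij]; first by rewrite setIid;
    exact: prob_event.
  by apply: corr_const => //; rewrite (inj_eq w_inj).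
- exact: measurable_box.
- by move=> i; rewrite !boxE.
- exact: zero_one_avg_lim.
Qed.

End Shift.

(** * The product formula *)

Theorem theorem1p7 (R : realType) (Delta : set R) (hDelta : distance_set Delta)
    (U : metricType R) (hU : urysohn_space Delta U)
    (dZ : measure_display) (Z : measurableType dZ) (hZ : standard_borel R Z)
    (mu : probability (power_space U Z) R)
    (mu_inv : shift_invariant mu) (mu_erg : shift_ergodic mu) :
  exists lambda : probability Z R, is_power_measure mu lambda.
Proof.
have [D0 _] := distance_set_multiples hDelta.
have [u0 _] : exists u0 : U, True.
  have [|//|h _] := @urysohn_realizes _ _ _ hU unit (fun _ _ => 0).
    by split=> // -[] [].
  by exists (h tt).
exists (distribution mu (coord u0)).
move=> s B + mB; elim: s => [_|u s IH /= /andP[us s_uniq]].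
  rewrite big_nil (_ : [set z | _] = setT) ?probability_setT//.
  by apply/seteqP; split.
rewrite big_cons -IH//.
pose p (i : seq_sub s) : U := ssval i.
have boxE : [set z : power_space U Z | forall v, v \in s -> B v (z v)] =
    box p (fun i => B (p i)).
  apply/seteqP; split => z zB; first by move=> i; apply: zB; exact: ssvalP.
  by move=> v vs; exact: (zB (SeqSub vs)).
have -> : [set z : power_space U Z | forall v, v \in u :: s -> B v (z v)] =
    event (B u) u `&` box p (fun i => B (p i)).
  rewrite -boxE; apply/seteqP; split => [z zB|z [zu zB] v].
    by split => [|v vs]; apply: zB; rewrite inE ?eqxx// vs orbT.
  by rewrite inE => /predU1P[->//|]; exact: zB.
have mbox : measurable (box p (fun i => B (p i))) by exact: measurable_box.
have mBu : measurable (event (B u) u) by exact: measurable_event.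
rewrite boxE -(EFin_prob mu mbox) -EFin_prob; last exact: measurableI.
rewrite (event_box_independent hDelta hU mu_inv)//.
- rewrite EFinM; congr (_ * _)%E.
  rewrite (prob_event hU mu_inv _ u u0)// EFin_prob//.
  exact: measurable_event.
- exact: val_inj.
- by move=> i; apply: contraNneq us => <-; exact: ssvalP.
Qed.
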